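(* In the $n$-node line network described in the context, with rates $\mu_0,\ldots,\mu_{n-1}>0$, for every integer $m\ge1$ the stationary $m$th moment age vector exists and equals $$\lim_{t\to\infty}\left[\mathbb{E}[x_1^m(t)]\ \ \mathbb{E}[x_2^m(t)]\ \cdots\ \mathbb{E}[x_n^m(t)]\right]=m!\,[1\ \cdots\ 1]\,\mathbf{U}^m,$$ where $\mathbf{U}$ is the $n\times n$ upper triangular matrix whose row $i$ (indexed $i=0,\ldots,n-1$) has entries $1/\mu_i$ in columns $i,i+1,\ldots,n-1$ and $0$ in columns $0,\ldots,i-1$.
   Context: The line network is the following age process. There are monitors at nodes $1,\ldots,n$ with ages $\mathbf{x}(t)=[x_1(t)\ \cdots\ x_n(t)]$; each age grows at unit rate between events. There are $n$ independent Poisson event processes with rates $\mu_0,\ldots,\mu_{n-1}$. At an event of process $0$ (a fresh update delivered to node 1), $x_1$ is reset to $0$ and all other ages are unchanged. At an event of process $l\in\{1,\ldots,n-1\}$ (node $l$ forwards its current update to node $l+1$), $x_{l+1}$ is reset to $x_l$ and all other ages are unchanged. (Equivalently, this is the age process of a line of preemptive memoryless $\cdot$/M/1/1 servers with service rates $\mu_1,\ldots,\mu_{n-1}$ fed by a rate-$\mu_0$ Poisson source of fresh updates.) *)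

(* Defs.v *)
Set Warnings "-notation-overridden,-ambiguous-paths,-notation-incompatible-prefix".
From HB Require Import structures.
From mathcomp Require Import all_boot all_order all_algebra.
From mathcomp Require Import all_classical all_reals all_analysis.
Set Implicit Arguments. Unset Strict Implicit. Unset Printing Implicit Defensive.
Import Order.TTheory GRing.Theory Num.Theory.
Local Open Scope classical_set_scope.
Local Open Scope ring_scope.

Definition mutually_independent d (Omega : measurableType d) (R : realType)
  (P : probability Omega R) (I : eqType) (X : I -> {RV P >-> R}) : Prop :=
  forall (s : seq I) (B : I -> set R),
    uniq s -> (forall i, i \in s -> measurable (B i)) ->
    P (\big[setI/setT]_(i <- s) (X i @^-1` B i)) =
    (\prod_(i <- s) P (X i @^-1` B i))%E.

Section line_network.
Context {R : realType} {Omega : Type}.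

Definition event_time (S : nat -> R) (k : nat) : R := \sum_(i < k.+1) S i.

(* time of the last event at or before t (meaningful when one exists) *)
Definition last_event (S : nat -> R) (t : R) : R :=
  sup [set event_time S k | k in [set k | event_time S k <= t]].

Variable n : nat.
(* x0 j : initial age at node j+1;  T l k w : k-th inter-event time of
   the rate-mu_l Poisson process l, in outcome w. *)
Variables (x0 : 'I_n -> R) (T : 'I_n -> nat -> Omega -> R).

Let x0n (j : nat) : R := oapp x0 0 (insub j).
Let Tn (j : nat) (k : nat) (w : Omega) : R := oapp (fun i => T i k w) 0 (insub j).

(* generation time (time stamp) of the update held at node j+1 at time t;
   node j+1 is reset only by events of process j: process 0 delivers a fresh
   update (stamp = event time), process j>0 copies the update of node j. *)
Fixpoint gen_time (j : nat) (t : R) (w : Omega) : R :=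
  let S := fun k => Tn j k w in
  if `[< exists k, event_time S k <= t >] then
    match j with
    | 0 => last_event S t
    | j'.+1 => gen_time j' (last_event S t) w
    end
  else - x0n j.

Definition line_age (j : 'I_n) (t : R) (w : Omega) : R := t - gen_time j t w.

End line_network.

Definition Umx {R : realType} (n : nat) (mu : 'I_n -> R) : 'M[R]_n :=
  \matrix_(i < n, j < n) (if (i <= j)%N then (mu i)^-1 else 0).

(* Main.v *)
(** Fix [u > 0].  The update held by node [j] at time [t] was generated at or
    after [u] exactly when an update generated at or after [u] has travelled down
    to node [j] by time [t].  The travel time is obtained by waiting, from node to
    node, for the next event of a Poisson process which is independent of the past.
    By the memoryless property these waits are independent exponential variables,
    so that on [0, t) the age of node [j] has the law of the sum of independent
    exponentials of rates mu_0, ..., mu_j, whatever [t].  Integrating by parts, the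
    moments c_(m, j) of these sums satisfy
    c_(m+1, j) = c_(m+1, j-1) + (m+1) / mu_j * c_(m, j), which is the recursion of
    m! [1 ... 1] U^m.  Since the age at time [t] is at most [t] plus a constant, the
    event that it exceeds [t] perturbs the m-th moment by O(1/t) only. *)
Require Import Defs.
Set Warnings "-notation-overridden,-ambiguous-paths,-notation-incompatible-prefix".
From HB Require Import structures.
From mathcomp Require Import all_boot all_order all_algebra.
From mathcomp Require Import all_classical all_reals all_analysis.
From mathcomp Require Import measurable_realfun ring.
Import Order.TTheory GRing.Theory Num.Theory.
Import numFieldNormedType.Exports HBNNSimple.
Set Implicit Arguments. Unset Strict Implicit. Unset Printing Implicit Defensive.
Local Open Scope classical_set_scope.
Local Open Scope ring_scope.

(** * Independence of the past *)

Section independence.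
Context {d} {Omega : measurableType d} {R : realType} {P : probability Omega R}.
Context {I : choiceType} (X : I -> {RV P >-> R}).
Implicit Type J : set I.

(** The pi-system generating the sigma-algebra of the [X i] with [i] in [J]. Measurability of [B i]
    is asked at every index, so that families attached to different lists can be combined without
    side conditions. *)
Definition cylinder J : set (set Omega) := [set E | exists s B,
  [/\ uniq s, forall i, i \in s -> J i, forall i : I, measurable (B i) &
      E = \bigcap_(i in [set` s]) X i @^-1` B i]].

Lemma cylinder_setI_closed J : setI_closed (cylinder J).
Proof.
move=> _ _ [s [B [us sJ mB ->]]] [s' [B' [us' sJ' mB' ->]]].
exists (undup (s ++ s')).
exists (fun i => (if i \in s then B i else setT) `&`
                 (if i \in s' then B' i else setT)).
split; first exact: undup_uniq.
- by move=> i; rewrite mem_undup mem_cat => /orP[/sJ|/sJ'].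
- by move=> i; apply: measurableI; case: ifP.
rewrite eqEsubset; split=> w /=.
- move=> [h h'] i /=; rewrite mem_undup mem_cat => _; split.
  + by case: ifP => // /h.
  + by case: ifP => // /h'.
- move=> h; split => i /= is_; have := h i; rewrite /= mem_undup mem_cat is_ ?orbT.
  + by case=> // + _.
  + by case=> // _.
Qed.

(** [Omega] itself with the sigma-algebra generated by the [X i], [i] in [J]: depending on the past
    only becomes measurability of a function on this type. *)
Local Notation history J := (g_sigma_algebraType (cylinder J)).

Lemma cylinder_measurable J : cylinder J `<=` measurable.
Proof.
move=> _ [s [B [_ _ mB ->]]].
apply: fin_bigcap_measurable => // i _.
exact: measurable_funPTI.
Qed.

Lemma history_measurable J (A : set (history J)) :
  measurable A -> (measurable : set (set Omega)) A.
Proof.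
apply: smallest_sub; last exact: cylinder_measurable.
exact: sigma_algebra_measurable.
Qed.

Lemma measurable_id_history J : measurable_fun setT (id : Omega -> history J).
Proof. by move=> _ A /history_measurable mA; rewrite setTI. Qed.

Lemma measurable_history J i : J i -> measurable_fun setT (X i : history J -> R).
Proof.
move=> Ji _ B mB; rewrite setTI; apply: sub_sigma_algebra.
exists [:: i], (fun=> B); split => //.
- by move=> k; rewrite inE => /eqP ->.
- by rewrite bigcap_seq big_seq1.
Qed.

Hypothesis indepX : mutually_independent X.

(** For fixed [B], both sides are finite measures in [A]; they agree on the cylinders, a pi-system,
    hence on the whole history. *)
Lemma independent_history J i (A : set (history J)) (B : set R) :
  ~ J i -> measurable A -> measurable B ->
  P (A `&` X i @^-1` B) = (P A * P (X i @^-1` B))%E.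
Proof.
move=> nJi mA mB.
have mXB : measurable (X i @^-1` B).
  exact: measurable_funPTI.
rewrite muleC.
pose k : {nonneg R} := NngNum (fine_ge0 (measure_ge0 P (X i @^-1` B))).
have kE : (k%:num)%:E = P (X i @^-1` B) by rewrite /= fineK// fin_num_measure.
rewrite -kE.
apply: (@g_sigma_algebra_measure_unique_trace _ _ _ (cylinder J) setT
  measurableT _ _ (mrestr P mXB) (mscale k P)).
- by move=> E [/cylinder_measurable].
- move=> E F [cE _] [cF _]; split => //; exact: cylinder_setI_closed.
- by rewrite /= /mrestr /mscale /= setTI probability_setT mule1 kE.
- move=> _ [[s [C [us sJ mC ->]]] _].
  rewrite /= /mrestr /mscale /= kE.
  have nis : i \notin s by apply/negP => /sJ.
  (* As [i] is not in [s], inserting [B] at index [i] leaves the cylinder unchanged, and the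
     hypothesis of independence applies to the list [i :: s]. *)
  pose C' j := if j == i then B else C j.
  have eC' j : j \in s -> C' j = C j.
    by move=> js; rewrite /C'; case: eqP => // ji; rewrite -ji js in nis.
  have mC' j : measurable (C' j) by rewrite /C'; case: ifP.
  have sE : \bigcap_(j in [set` s]) X j @^-1` C j =
            \big[setI/setT]_(j <- s) (X j @^-1` C' j).
    by rewrite bigcap_seq; apply: eq_big_seq => j js; rewrite eC'.
  have C'i : C' i = B by rewrite /C' eqxx.
  have usi : uniq (i :: s) by rewrite /= nis us.
  have := indepX usi (fun j _ => mC' j).
  rewrite !big_cons C'i -sE setIC => ->; congr (_ * _)%E.
  by rewrite sE indepX.
- by rewrite /= /mrestr setTI (le_lt_trans (probability_le1 P mXB)) ?ltry.
- by [].
- suff -> : [set E | cylinder J E /\ E `<=` setT] = cylinder J by exact: mA.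
  by rewrite eqEsubset; split=> E //= [].
Qed.


(** Conditioning on the past: by independence the pair (past, [X i]) has a product law, and
    Fubini-Tonelli integrates the new variable with the past frozen. *)
Lemma integral_independent_history J i (f : history J * R -> \bar R) :
  ~ J i -> measurable_fun setT f -> (forall z, 0 <= f z)%E ->
  (\int[P]_w f (w, X i w) =
   \int[P]_w \int[distribution P (X i)]_x f (w, x))%E.
Proof.
move=> nJi mf f0.
pose idJ : {mfun Omega >-> history J} :=
  HB.pack (id : Omega -> history J)
    (isMeasurableFun.Build _ _ _ _ _ (@measurable_id_history J)).
have mXi : measurable_fun setT (fun w : Omega => (w : history J, X i w)).
  exact: measurable_fun_pair (@measurable_id_history J) (measurable_funPT (X i)).
pose pairX : {mfun Omega >-> (history J * R)%type} :=
  HB.pack (fun w : Omega => (w : history J, X i w))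
    (isMeasurableFun.Build _ _ _ _ _ mXi).
pose PJ : probability (history J) R := distribution P idJ.
have mF := @measurable_fun_fubini_tonelli_F _ _ _ _ _ (distribution P (X i)) _ mf f0.
have := @ge0_integral_distribution _ _ _ _ _ P pairX f mf f0.
rewrite /comp /= => <-.
transitivity (\int[PJ \x distribution P (X i)]_z f z)%E.
  apply: eq_measure_integral => /= A mA _; apply/esym.
  apply: product_measure_unique => // B C mB mC.
  exact: (@independent_history J i B C nJi mB mC).
rewrite fubini_tonelli1//.
rewrite (@ge0_integral_distribution _ _ _ _ _ P idJ)//.
by move=> y; apply: integral_ge0.
Qed.

End independence.

(** * Exponential laws *)

(** Simple functions increasing to [f] reduce the claim, by monotone convergence on both sides, to
    indicators of level sets, where it is the hypothesis on [nu]. *)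
Lemma ge0_integral_density d (T : measurableType d) (R : realType)
  (m nu : {measure set T -> \bar R}) (g : T -> R) (f : T -> \bar R) :
  measurable_fun setT g -> (forall x, 0 <= g x) ->
  (forall A, measurable A -> nu A = \int[m]_(x in A) (g x)%:E)%E ->
  measurable_fun setT f -> (forall x, 0 <= f x)%E ->
  (\int[nu]_x f x = \int[m]_x (f x * (g x)%:E))%E.
Proof.
move=> mg g0 nuE mf f0.
pose h := nnsfun_approx measurableT mf.
have fE x : f x = limn (fun n => (h n x)%:E).
  by apply/esym/cvg_lim => //; exact: cvg_nnsfun_approx.
have mEg : measurable_fun setT (EFin \o g) by exact/measurable_EFinP.
transitivity (limn (fun n => \int[nu]_x (h n x)%:E))%E.
  under eq_integral => x _ do rewrite fE.
  apply: monotone_convergence => //.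
  - by move=> n; exact/measurable_EFinP.
  - by move=> n x _; rewrite lee_fin.
  - by move=> x _ a b ab; rewrite lee_fin; exact/lefP/nd_nnsfun_approx.
transitivity (limn (fun n => \int[m]_x ((h n x)%:E * (g x)%:E)))%E; last first.
  have fg x : (f x * (g x)%:E = limn (fun n => (h n x)%:E * (g x)%:E))%E.
    apply/esym/cvg_lim => //; apply: cvgeZr => //.
    exact: cvg_nnsfun_approx.
  under [RHS]eq_integral => x _ do rewrite fg.
  apply/esym/monotone_convergence => //.
  - by move=> n; apply/emeasurable_funM => //; exact/measurable_EFinP.
  - by move=> n x _; rewrite mule_ge0// lee_fin.
  - move=> x _ a b ab; rewrite lee_wpmul2r ?lee_fin//.
    exact/lefP/nd_nnsfun_approx.
apply: congr_lim; apply/funext => n.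
under eq_integral do rewrite fimfunE -fsumEFin//.
under [RHS]eq_integral do rewrite fimfunE -fsumEFin//.
have mind r : measurable_fun setT (fun x => (r * \1_(h n @^-1` [set r]) x)%:E).
  by apply/measurable_EFinP; exact: measurable_funM.
rewrite ge0_integral_fsum//; last first.
  by move=> y x _; rewrite /= EFinM; exact: nnfun_muleindic_ge0.
under [RHS]eq_integral => x _.
  rewrite ge0_mule_fsuml; last by move=> y; rewrite /= EFinM; exact: nnfun_muleindic_ge0.
  over.
rewrite ge0_integral_fsum//; last 2 first.
- by move=> y; exact: emeasurable_funM.
- move=> y x _; rewrite mule_ge0//; last by rewrite lee_fin.
  by rewrite /= EFinM; exact: nnfun_muleindic_ge0.
apply: eq_fsbigr => r /set_mem [x _ <-].
have hn0 : (0 <= (h n x)%:E)%E by rewrite lee_fin.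
under eq_integral do rewrite EFinM.
under [RHS]eq_integral do rewrite EFinM -muleA.
rewrite !ge0_integralZl//; last 3 first.
- by apply: emeasurable_funM => //; exact/measurable_EFinP.
- by move=> y _; rewrite mule_ge0 ?lee_fin.
- exact/measurable_EFinP.
congr (_ * _)%E.
rewrite integral_indic// setIT nuE// integral_mkcond.
apply: eq_integral => y _; rewrite patchE indicE.
by case: ifP => _; rewrite ?mul1e ?mul0e.
Qed.

Section exponential.
Context {R : realType} (nu : probability R R) (mu : R).
Hypothesis mu_gt0 : 0 < mu.
Hypothesis nuE : forall A, measurable A -> nu A = exponential_prob mu A.

Lemma ge0_integral_exponential (f : R -> \bar R) :
  measurable_fun setT f -> (forall x, 0 <= f x)%E ->
  (\int[nu]_x f x = \int[lebesgue_measure]_x (f x * (exponential_pdf mu x)%:E))%E.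
Proof.
move=> mf f0.
have mid : measurable_fun setT (id : R -> measurableTypeR R).
  by move=> _ A mA; rewrite setTI.
have mf' : measurable_fun setT (f : measurableTypeR R -> \bar R) by exact: mf.
(* Pushing forward by the identity puts [nu] on the measurable type that carries Lebesgue
   measure. *)
transitivity (\int[pushforward nu (id : R -> measurableTypeR R)]_x f x)%E.
  by rewrite (ge0_integral_pushforward mid).
apply: (ge0_integral_density (m := lebesgue_measure)
  (nu := pushforward nu (id : R -> measurableTypeR R)) (g := exponential_pdf mu)) => //.
- exact: measurable_exponential_pdf.
- by move=> x; apply: exponential_pdf_ge0; exact: ltW.
Qed.

Lemma cvg_poly_expR0 (s : R) m :
  (s + r) ^+ m * expR (- mu * r) @[r --> +oo] --> 0.
Proof.
(* From [x ^+ m.+1 / m.+1!] <= [expR x] at [x = mu * (s + r)], the expression is at most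
   [C / (s + r)]; the factor [expR (mu * s)] accounts for the exponent being [- mu * r] only. *)
pose C := expR (mu * s) * m.+1`!%:R / mu ^+ m.+1.
have C0 : 0 < C by rewrite !mulr_gt0 ?expR_gt0 ?invr_gt0 ?exprn_gt0 ?ltr0n ?fact_gt0.
apply/(@cvgrPdist_lt _ R^o) => e e0; near=> r.
have sr0 : 0 < s + r.
  by rewrite addrC -ltrBlDr sub0r; near: r; apply: nbhs_pinfty_gt; rewrite num_real.
rewrite sub0r normrN ger0_norm ?mulr_ge0 ?exprn_ge0 ?expR_ge0 ?ltW//.
apply: (@le_lt_trans _ _ (C / (s + r))); last first.
  rewrite ltr_pdivrMr// -ltr_pdivrMl// -ltrBlDl.
  by near: r; apply: nbhs_pinfty_gt; rewrite num_real.
have := expR_ge1Dxn m (ltW (mulr_gt0 mu_gt0 sr0)).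
move=> /(le_trans _) h.
have {h} : (mu * (s + r)) ^+ m.+1 / m.+1`!%:R <= expR (mu * (s + r)).
  by apply: h; rewrite lerDr.
rewrite [in expR _]mulrDr expRD ler_pdivrMr ?ltr0n ?fact_gt0// => h.
rewrite mulNr expRN ler_pdivlMr// mulrAC -exprSr ler_pdivrMr ?expR_gt0//.
rewrite /C mulrAC ler_pdivlMr ?exprn_gt0// -exprMn [_ * mu]mulrC.
by rewrite [leRHS]mulrAC.
Unshelve. all: by end_near. Qed.

(* [tail_integral s m r] is the integral over [r, +oo[ of
   x |-> (s + x)^m mu e^(- mu x), computed by parts. *)
Fixpoint tail_integral (s : R) m (r : R) : R :=
  if m is m'.+1 then
    (s + r) ^+ m'.+1 * expR (- mu * r) + m'.+1%:R / mu * tail_integral s m' r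
  else expR (- mu * r).

Lemma cvg_tail_integral s m : tail_integral s m r @[r --> +oo] --> 0.
Proof.
elim: m => [|m IH] /=.
  have := cvg_poly_expR0 0 0.
  by under eq_fun do rewrite expr0 mul1r.
rewrite -[X in _ --> X]addr0 -{2}(mulr0 (m.+1%:R / mu)).
by apply: cvgD; [exact: cvg_poly_expR0|exact: cvgMl_tmp].
Qed.

Lemma is_derive_tail_integral (s : R) m (r : R) :
  is_derive r 1 (tail_integral s m) (- ((s + r) ^+ m * (mu * expR (- mu * r)))).
Proof.
have dE : is_derive r 1 (fun r : R => expR (- mu * r)) (- mu * expR (- mu * r)).
  by apply: is_derive_eq; rewrite /GRing.scale/=; ring.
have dP k : is_derive r 1 (fun r => (s + r) ^+ k) (k%:R * (s + r) ^+ k.-1).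
  have -> : (fun r => (s + r) ^+ k) = (fun r => s + r) ^+ k.
    by apply/funext => x; rewrite exprfctE.
  by apply: is_derive_eq; rewrite /GRing.scale/=; ring.
elim: m => [|m IH] /=.
  by apply: is_derive_eq; rewrite expr0; ring.
apply: (is_derive_eq (is_deriveD (is_deriveM (dP m.+1) dE)
  (is_deriveZ (m.+1%:R / mu) IH))).
by rewrite /GRing.scale/= exprS; field; rewrite gt_eqF.
Qed.

Lemma continuous_tail_integral s m : continuous (tail_integral s m).
Proof.
move=> r; apply/differentiable_continuous/derivable1_diffP.
by have [] := is_derive_tail_integral s m r.
Qed.

(** The density vanishes on negative [r], and elsewhere [s + r] is its own absolute value. There
    [- tail_integral s m] is an antiderivative tending to 0 at infinity, so only its value at 0
    remains. *)
Lemma integral_exponential_shift_exp s m : 0 <= s ->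
  (\int[nu]_r (`|s + r| ^+ m)%:E = (tail_integral s m 0)%:E)%E.
Proof.
move=> s0.
have msr : measurable_fun setT (fun r : R => `|s + r| ^+ m).
  apply: measurable_funX; apply: measurableT_comp => //.
  exact: measurable_funD.
rewrite ge0_integral_exponential//; last exact/measurable_EFinP.
transitivity (\int[lebesgue_measure]_(r in `[0%R, +oo[)
    ((s + r) ^+ m * (mu * expR (- mu * r)))%:E)%E.
  rewrite [RHS]integral_mkcond; apply: eq_integral => r _.
  rewrite patchE -EFinM; case: ifPn => [|/negP r0].
    rewrite inE/= in_itv/= andbT => r0.
    by rewrite ger0_norm ?addr_ge0// exponential_pdfE.
  rewrite lt0_exponential_pdf ?mulr0// ltNge; apply/negP => r0'; apply: r0.
  by rewrite inE/= in_itv/= r0'.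
rewrite (@ge0_continuous_FTC2y _ _ (fun r => - tail_integral s m r) _ 0).
- by rewrite sub0e EFinN oppeK.
- move=> r r0; rewrite mulr_ge0 ?exprn_ge0 ?addr_ge0//.
  by rewrite mulr_ge0 ?expR_ge0// ltW.
- apply: continuous_subspaceT => r.
  apply: (@cvgM _ _ (nbhs r) _ (fun r : R => (s + r) ^+ m)
    (fun r : R => mu * expR (- mu * r))).
    apply: (@continuous_comp _ _ _ (fun r : R => s + r) (fun r => r ^+ m)).
      by apply: cvgD; [exact: cvg_cst|exact: cvg_id].
    exact: exprn_continuous.
  have dg : is_derive r 1 (fun r : R => mu * expR (- mu * r))
      (- (mu * mu * expR (- mu * r))).
    by apply: is_derive_eq; rewrite /GRing.scale/=; ring.
  have [dg1 _] := dg.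
  exact: (differentiable_continuous ((derivable1_diffP _ _).1 dg1)).
- by rewrite -oppr0; apply: cvgN; exact: cvg_tail_integral.
- by move=> r _; have [] := is_derive_tail_integral s m r; move=> ? _; exact: derivableN.
- apply: cvgN; apply: cvg_at_right_filter; exact: continuous_tail_integral.
- move=> r _; rewrite derive1E.
  have dF := is_derive_tail_integral s m r.
  by rewrite derive_val opprK.
Qed.

(** The recursion defining [tail_integral], read at [r = 0]; averaging it over [s] will give the
    moment recursion along the line. *)
Lemma integral_exponential_shift_expS s m : 0 <= s ->
  (\int[nu]_r (`|s + r| ^+ m.+1)%:E =
   (s ^+ m.+1)%:E + (m.+1%:R / mu)%:E * \int[nu]_r (`|s + r| ^+ m)%:E)%E.
Proof.
move=> s0; rewrite !integral_exponential_shift_exp//=.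
by rewrite mulr0 expR0 mulr1 addr0.
Qed.

Lemma exponential_tail (a : R) : 0 <= a ->
  nu `[a, +oo[%classic = (expR (- mu * a))%:E.
Proof.
move=> a0; rewrite nuE// /exponential_prob.
have dF (r : R) : is_derive r 1 (fun r => - expR (- mu * r)) (mu * expR (- mu * r)).
  by apply: is_derive_eq; rewrite /GRing.scale/=; ring.
rewrite (@ge0_continuous_FTC2y _ _ (fun r => - expR (- mu * r)) _ 0).
- by rewrite sub0e EFinN oppeK.
- by move=> r _; rewrite exponential_pdf_ge0// ltW.
- apply: (@continuous_subspaceW R^o _ _ [set` `[0, +oo[%R]).
    by apply: subset_itvr; rewrite bnd_simp.
  exact: within_continuous_exponential_pdf.
- rewrite -oppr0; apply: cvgN; have := cvg_poly_expR0 0 0.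
  by under eq_fun do rewrite expr0 mul1r.
- by move=> r _; have [] := dF r.
- have [dFa _] := dF a; apply: cvg_at_right_filter.
  exact: (differentiable_continuous ((derivable1_diffP _ _).1 dFa)).
- move=> r; rewrite in_itv/= andbT => ar.
  by rewrite derive1E derive_val exponential_pdfE// (le_trans a0)// ltW.
Qed.

Lemma exponential_tail_le0 (a : R) : a <= 0 -> nu `[a, +oo[%classic = 1%E.
Proof.
move=> a0; apply/eqP; rewrite eq_le probability_le1//=.
have := exponential_tail (lexx 0); rewrite mulr0 expR0 => <-.
rewrite le_measure ?inE//.
by apply: subset_itvr; rewrite bnd_simp.
Qed.

(** Two measures are compared: [nu] restricted to [[y, +oo[], and [expR (- mu * y)] times the law of
    [y + r]. They agree on the half-lines [[a, +oo[], which form a generating pi-system, by the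
    formula for the exponential tail. *)
Lemma exponential_memoryless (y : R) (f : R -> \bar R) : 0 <= y ->
  measurable_fun setT f -> (forall x, 0 <= f x)%E ->
  (\int[nu]_(x in `[y, +oo[) f x =
   (expR (- mu * y))%:E * \int[nu]_r f (y + r)%R)%E.
Proof.
move=> y0 mf f0.
have mI : measurable (`[y, +oo[%classic : set R) by [].
have mD : measurable_fun setT (fun r : R => y + r) by exact: measurable_funD.
pose shift : {mfun R >-> R} :=
  HB.pack (fun r : R => y + r) (isMeasurableFun.Build _ _ _ _ _ mD).
pose k : {nonneg R} := NngNum (expR_ge0 (- mu * y)).
have e0 : (0 <= (expR (- mu * y))%:E)%E by rewrite lee_fin expR_ge0.
transitivity (\int[mrestr nu mI]_x f x)%E.
  rewrite (@ge0_integral_density _ _ _ nu (mrestr nu mI) \1_(`[y, +oo[))//.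
  - rewrite [LHS]integral_mkcond; apply: eq_integral => r _; rewrite patchE indicE.
    by case: ifP => _; rewrite ?mule1 ?mule0.
  - by move=> A mA; rewrite integral_indic// setIC.
transitivity (\int[mscale k (distribution nu shift)]_x f x)%E.
  apply: eq_measure_integral => /= A mA _.
  apply: (measure_unique (@RGenCInfty.G R) (fun n => `[- n%:R, +oo[%classic)) => //.
  - exact: RGenCInfty.measurableE.
  - move=> _ _ [a ->] [b ->]; exists (Num.max a b).
    rewrite eqEsubset; split=> r /=; rewrite !in_itv/= !andbT ge_max.
      by move=> [-> ->].
    by move=> /andP[].
  - by move=> n; exists (- n%:R).
  - rewrite -subTset => r _; exists (Num.truncn `|r|).+1 => //=.
    rewrite in_itv/= andbT lerNl (le_trans (ler_norm _))// normrN.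
    by rewrite ltW// truncnS_gt.
  - move=> _ [a ->].
    transitivity (nu `[Num.max a y, +oo[%classic).
      congr (nu _); apply/seteqP.
      by split=> r /=; rewrite !in_itv/= !andbT ge_max; [move=> [-> ->]|move/andP].
    transitivity ((expR (- mu * y))%:E * nu `[(a - y)%R, +oo[%classic)%E; last first.
      by congr (_ * nu _)%E; apply/seteqP; split=> r /=; rewrite !in_itv/= !andbT lerBlDl.
    (* If [a <= y] the half-line adds no constraint and the threshold [a - y] has tail 1; otherwise
       the two exponents add up to [- mu * a]. *)
    have [ay|ya] := leP a y.
      by rewrite exponential_tail// exponential_tail_le0 ?mule1// subr_le0.
    rewrite !exponential_tail; last 2 first.
    - by rewrite subr_ge0 ltW.
    - by rewrite (le_trans y0)// ltW.
    by rewrite -EFinM -expRD; congr (expR _)%:E; ring.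
  - move=> n; rewrite /= /mrestr (le_lt_trans (probability_le1 _ _)) ?ltry//.
    exact: measurableI.
by rewrite ge0_integral_mscale// ge0_integral_distribution.
Qed.

End exponential.

(** * The first event after a given time *)

Section next_event.
Context {R : realType}.
Implicit Types (S : nat -> R) (u : R).

Definition first_passage S u k : Prop := u <= S k /\ forall i, (i < k)%N -> S i < u.

(* The junk value 0 is taken when no event occurs at or after u. *)
Definition next_event S u : R :=
  if pselect (exists k, u <= S k) is left e then S (ex_minn e) else 0.

Lemma first_passage_exists S u : (exists k, u <= S k) -> exists k, first_passage S u k.
Proof.
move=> e; case: (ex_minnP e) => k uk kmin; exists k; split => // i ik.
by rewrite ltNge; apply/negP => /kmin; rewrite leqNgt ik.
Qed.

Lemma first_passage_uniq S u k l : first_passage S u k -> first_passage S u l -> k = l.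
Proof.
move=> [uk ku] [ul lu]; case: (ltngtP k l) => // [/lu|/ku].
  by rewrite ltNge uk.
by rewrite ltNge ul.
Qed.

Lemma next_eventE S u k : first_passage S u k -> next_event S u = S k.
Proof.
move=> fk; rewrite /next_event; case: pselect => [e|[]]; last by exists k; case: fk.
case: (ex_minnP e) => l ul lmin; congr S; apply: first_passage_uniq fk.
split=> // i il; rewrite ltNge; apply/negP => /lmin.
by rewrite leqNgt il.
Qed.

Lemma next_event_none S u : ~ (exists k, u <= S k) -> next_event S u = 0.
Proof. by rewrite /next_event; case: pselect. Qed.

Lemma next_event_ge0 S u : 0 <= u -> 0 <= next_event S u.
Proof.
move=> u0; have [/first_passage_exists[k fk]|/next_event_none->//] :=
  pselect (exists k, u <= S k).
by rewrite (next_eventE fk) (le_trans u0)//; case: fk.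
Qed.

(** Forward half of a duality whose backward half is [last_event_ge]: both conditions reduce to the
    presence of an event in a time window. *)
Lemma next_event_le S u t : {homo S : i j / (i <= j)%N >-> i <= j} ->
  (exists k, u <= S k) -> next_event S u <= t <-> exists k, u <= S k <= t.
Proof.
move=> ndS /first_passage_exists[k fk]; rewrite (next_eventE fk); split=> [kt|].
  by exists k; rewrite kt andbT; case: fk.
move=> [l /andP[ul]]; apply: le_trans; apply: ndS.
by rewrite leqNgt; apply/negP; case: fk => _ + lk => /(_ _ lk); rewrite ltNge ul.
Qed.

End next_event.

Section measurability.
Context {d} {T : measurableType d} {R : realType}.

Lemma measurable_set_ltr (f g : T -> R) : measurable_fun setT f ->
  measurable_fun setT g -> measurable [set x | f x < g x].
Proof.
move=> mf mg; rewrite (_ : [set x | _] = setT `&` (fun x => f x < g x) @^-1` [set true]).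
  exact: (measurable_fun_ltr mf mg measurableT).
by apply/seteqP; split=> x //= [].
Qed.

Lemma measurable_set_ler (f g : T -> R) : measurable_fun setT f ->
  measurable_fun setT g -> measurable [set x | f x <= g x].
Proof.
move=> mf mg; rewrite (_ : [set x | _] = setT `&` (fun x => f x <= g x) @^-1` [set true]).
  exact: (measurable_fun_ler mf mg measurableT).
by apply/seteqP; split=> x //= [].
Qed.

Lemma measurable_bounded_forall (Q : nat -> T -> Prop) k :
  (forall i, (i < k)%N -> measurable [set w | Q i w]) ->
  measurable [set w | forall i, (i < k)%N -> Q i w].
Proof.
move=> mQ.
rewrite (_ : [set w | _] = \bigcap_(i in [set i | (i < k)%N]) [set w | Q i w])//.
by apply: bigcap_measurableType => i; exact: mQ.
Qed.

Context (S : nat -> T -> R) (u : T -> R).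
Hypothesis mS : forall k, measurable_fun setT (S k).
Hypothesis mu : measurable_fun setT u.

Lemma measurable_no_passage k :
  measurable [set w | forall i, (i < k)%N -> S i w < u w].
Proof. by apply: measurable_bounded_forall => i _; exact: measurable_set_ltr. Qed.

Lemma measurable_first_passage k :
  measurable [set w | first_passage (S ^~ w) (u w) k].
Proof.
apply: measurableI; first exact: measurable_set_ler.
exact: measurable_no_passage.
Qed.

Lemma measurable_exists_event : measurable [set w | exists k, u w <= S k w].
Proof.
rewrite (_ : [set w | _] = \bigcup_k [set w | u w <= S k w]).
  by apply: bigcupT_measurable => k; exact: measurable_set_ler.
by apply/seteqP; split=> w /= [k]; [exists k|move=> _ ?; exists k].
Qed.

Lemma measurable_next_event : measurable_fun setT (fun w => next_event (S ^~ w) (u w)).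
Proof.
move=> _; apply: (measurability _ (RGenInftyO.measurableE R)) => //.
move=> _ [_ [v ->] <-]; rewrite setTI.
(* The preimage is split by the index of first passage; the last piece is where no event occurs and
   the default value 0 is taken. *)
rewrite (_ : _ @^-1` _ =
  (\bigcup_k ([set w | first_passage (S ^~ w) (u w) k] `&` [set w | S k w < v]))
  `|` (~` [set w | exists k, u w <= S k w] `&` [set w | 0 < v])); last first.
  apply/seteqP; split=> w /=; rewrite in_itv/=.
  - have [/first_passage_exists[k fk]|n] := pselect (exists k, u w <= S k w).
      by rewrite (next_eventE fk) => kv; left; exists k.
    by rewrite next_event_none// => v0; right.
  - by move=> [[k _ [fk kv]]|[n v0]]; rewrite ?(next_eventE fk)// next_event_none.
apply: measurableU.
  apply: bigcupT_measurable => k; apply: measurableI.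
    exact: measurable_first_passage.
  exact: measurable_set_ltr.
apply: measurableI; last exact: measurable_set_ltr.
by apply: measurableC; exact: measurable_exists_event.
Qed.

End measurability.

Lemma measurable_event_time d (T : measurableType d) (R : realType)
  (X : nat -> T -> R) k :
  (forall i, (i <= k)%N -> measurable_fun setT (X i)) ->
  measurable_fun setT (fun w => event_time (X ^~ w) k).
Proof.
move=> mX; rewrite /event_time.
by apply: measurable_sum => i; apply: mX; rewrite -ltnS.
Qed.

(** * Renewal at an independent time *)

Section renewal.
Context {d} {Omega : measurableType d} {R : realType} {P : probability Omega R}.
Context {I : choiceType} (X : I -> {RV P >-> R}).
Hypothesis indepX : mutually_independent X.
Context (nu : probability R R) (mu : R).
Hypothesis mu_gt0 : 0 < mu.
Hypothesis nuE : forall A, measurable A -> nu A = exponential_prob mu A.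
Context (p : nat -> I).
Hypothesis p_inj : injective p.
Hypothesis Xp : forall k A, measurable A ->
  distribution P (X (p k)) A = exponential_prob mu A.

Local Notation history J := (g_sigma_algebraType (cylinder X J)).
Local Notation S := (fun w => event_time (fun k => X (p k) w)).

Lemma measurable_history_sub d' (U : measurableType d') (J J' : set I)
  (f : Omega -> U) : J `<=` J' ->
  measurable_fun setT (f : history J -> U) -> measurable_fun setT (f : history J' -> U).
Proof.
move=> JJ' mf _ B mB; have := mf measurableT B mB; rewrite !setTI.
apply: sub_sigma_algebra2.
move=> _ [s [C [us sJ mC ->]]]; by exists s, C; split => // i /sJ /JJ'.
Qed.

Lemma measurable_from_history d' (U : measurableType d') (J : set I)
  (f : Omega -> U) :
  measurable_fun setT (f : history J -> U) -> measurable_fun setT f.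
Proof.
move=> mf _ B mB; rewrite setTI; apply: (@history_measurable _ _ _ _ _ X J).
by rewrite -[X in measurable X]setTI; exact: mf.
Qed.

Lemma ae_interarrival_ge0 : {ae P, forall w, forall k, 0 <= X (p k) w}.
Proof.
apply/ae_foralln => k; exists (X (p k) @^-1` `]-oo, 0[%classic); split.
- exact: measurable_funPTI.
- transitivity (nu `]-oo, 0[%classic).
    by rewrite nuE// -(Xp k).
  have -> : `]-oo, 0[%classic = ~` `[0, +oo[%classic :> set R by rewrite setCitvr.
  rewrite probability_setC// (exponential_tail mu_gt0)//.
  by rewrite mulr0 expR0 subee.
- by move=> w /= /negP; rewrite in_itv/= -ltNge.
Qed.

Lemma measurable_bounded_interarrival (c : R) :
  measurable [set w | forall k, X (p k) w < c].
Proof.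
rewrite (_ : [set w | _] = \bigcap_k [set w | X (p k) w < c]).
  by apply: bigcapT_measurable => k; exact: measurable_set_ltr.
by apply/seteqP; split=> w /= h k *; exact: h.
Qed.

(** By independence the first [K] interarrival times are all below [c] with probability [q ^+ K],
    where [q = nu ]-oo, c[] is less than 1; let [K] grow. *)
Lemma bounded_interarrival0 (c : R) : P [set w | forall k, X (p k) w < c] = 0%E.
Proof.
pose B : set R := `]-oo, c[%classic.
have mB : measurable B by exact: measurable_itv.
have PB k : P (X (p k) @^-1` B) = (fine (nu B))%:E.
  by rewrite fineK ?fin_num_measure// nuE//; exact: Xp.
have nuB : (nu B < 1)%E.
  have -> : B = ~` `[c, +oo[%classic by rewrite setCitvr.
  rewrite probability_setC// lte_subel_addl// lteDr//.
  have [c0|c0] := leP 0 c.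
    by rewrite (exponential_tail mu_gt0)// lte_fin expR_gt0.
  by rewrite (exponential_tail_le0 mu_gt0)// ltW.
have le_pow K : (P [set w | forall k, (X (p k) w < c)%R] <= (fine (nu B) ^+ K)%:E)%E.
  have uK : uniq [seq p k | k <- iota 0 K].
    by rewrite map_inj_uniq ?iota_uniq.
  have := indepX uK (fun _ _ => measurable_itv `]-oo, c[).
  rewrite !big_map => E.
  apply: (@le_trans _ _ (P (\big[setI/setT]_(k <- iota 0 K) (X (p k) @^-1` B)))).
    apply: le_measure; rewrite ?inE//; first exact: measurable_bounded_interarrival.
      apply: bigsetI_measurable => k _.
      by apply: measurable_funPTI; exact: measurable_itv.
    by rewrite -bigcap_seq => w /= h k _ /=; rewrite /B/= in_itv/=.
  rewrite E (eq_bigr _ (fun k _ => PB k)).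
  rewrite big_const_seq count_predT size_iota.
  have -> : iter K (mule (fine (nu B))%:E) 1%E = (fine (nu B) ^+ K)%:E.
    by clear; elim: K => [|K IH]; rewrite ?expr0//= IH exprS EFinM.
  by [].
apply/eqP; rewrite eq_le measure_ge0 andbT.
have q1 : `|fine (nu B)| < 1.
  rewrite ger0_norm ?fine_ge0// -lte_fin fineK ?fin_num_measure//.
apply/lee_addgt0Pr => e e0; rewrite add0e.
have /cvgrPdist_lt /(_ e e0) [K _ /(_ K (leqnn _))] := cvg_expr q1.
rewrite /= sub0r normrN => Ke.
by rewrite (le_trans (le_pow K))// lee_fin (le_trans (ler_norm _))// ltW.
Qed.

(** Almost surely some single interarrival time exceeds any given integer; the others being
    nonnegative, the corresponding event time exceeds it too. *)
Lemma ae_event_time_unbounded :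
  {ae P, forall w, forall M : R, exists k, M <= S w k}.
Proof.
have := ae_interarrival_ge0.
have : {ae P, forall w, forall n, exists k, n%:R <= X (p k) w}.
  apply/ae_foralln => n; exists [set w | forall k, X (p k) w < n%:R]; split.
  - exact: measurable_bounded_interarrival.
  - exact: bounded_interarrival0.
  - move=> w /= h k; rewrite ltNge; apply/negP => nk; apply: h; by exists k.
apply: filterS2 => w h T0 M.
have [k nk] := h (Num.truncn `|M|).+1; exists k.
rewrite (le_trans _ (le_trans nk _))//.
  by rewrite (le_trans (ler_norm _))// ltW// truncnS_gt.
by rewrite /event_time big_ord_recr/= lerDr; apply: sumr_ge0.
Qed.

(* If the first k events precede [sigma], then event k is the first one at or
   after [sigma] iff the k-th interarrival time exceeds a residual threshold, and
   both conditions but that interarrival time are determined by the past. *)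
Lemma integral_first_passage (J : set I) (sigma : Omega -> R) k
  (G : history J * R -> \bar R) :
  (forall i, ~ J (p i)) ->
  measurable_fun setT (sigma : history J -> R) -> (forall w, 0 <= sigma w) ->
  measurable_fun setT G -> (forall z, 0 <= G z)%E ->
  (\int[P]_(w in [set w | first_passage (S w) (sigma w) k])
     G (w, (S w k - sigma w)%R) =
   \int[P]_(w in [set w | forall i, (i < k)%N -> (S w i < sigma w)%R])
     ((expR (- mu * (sigma w - \sum_(i < k) X (p i) w)))%:E
      * \int[nu]_r G (w, r)))%E.
Proof.
move=> nJp msigma sigma0 mG G0.
(* The past just before the [k]-th interarrival time: the given history together with the earlier
   interarrival times. *)
pose J' := J `|` [set p i | i in [set i | (i < k)%N]].
have nJ'p : ~ J' (p k) by move=> [/nJp//|[i /= ik /p_inj ik']]; rewrite ik' ltnn in ik.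
have JJ' : J `<=` J' by move=> i; left.
have mX i : (i < k)%N -> measurable_fun setT (X (p i) : history J' -> R).
  by move=> ik; apply: measurable_history; right; exists i.
pose prev w : R := \sum_(i < k) X (p i) w.
have mprev : measurable_fun setT (prev : history J' -> R).
  by apply: measurable_sum => i; exact: mX.
have mS i : (i < k)%N -> measurable_fun setT ((fun w => S w i) : history J' -> R).
  move=> ik; apply: (@measurable_event_time _ (history J') _ (fun i w => X (p i) w)).
  by move=> l li; apply: mX; exact: leq_ltn_trans ik.
have ms : measurable_fun setT (sigma : history J' -> R).
  exact: measurable_history_sub msigma.
have mid : measurable_fun setT (id : history J' -> history J).
  by apply: (measurable_history_sub JJ'); exact: measurable_id.
have SE w : S w k = prev w + X (p k) w by rewrite /event_time big_ord_recr.
(* The residual threshold is nonnegative: for [k = 0] it is [sigma] itself, otherwise [prev] is the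
   event time of index [k - 1], which precedes [sigma]. *)
have y0 w : (forall i, (i < k)%N -> S w i < sigma w) -> 0 <= sigma w - prev w.
  rewrite subr_ge0 /prev; case: k {J' nJ'p JJ' mX prev mprev mS ms mid SE} => [|k] h.
    by rewrite big_ord0.
  by rewrite ltW//; exact: (h k (ltnSn k)).
pose A : set (history J' * R) := [set z |
  (forall i, (i < k)%N -> S z.1 i < sigma z.1) /\ sigma z.1 <= prev z.1 + z.2].
pose H (z : history J' * R) := G (z.1, prev z.1 + z.2 - sigma z.1).
have mf1 : measurable_fun setT (fst : history J' * R -> history J') by exact: measurable_fst.
have mf2 : measurable_fun setT (snd : history J' * R -> R) by exact: measurable_snd.
have mA : measurable A.
  apply: measurableI.
    apply: measurable_bounded_forall => i ik; apply: measurable_set_ltr.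
      exact: measurableT_comp (mS i ik) mf1.
    exact: measurableT_comp ms mf1.
  apply: measurable_set_ler; first exact: measurableT_comp ms mf1.
  by apply: measurable_funD => //; exact: measurableT_comp mprev mf1.
have mH : measurable_fun setT H.
  apply: (measurableT_comp mG); apply: measurable_fun_pair.
    exact: measurableT_comp mid mf1.
  apply: measurable_funB; last exact: measurableT_comp ms mf1.
  by apply: measurable_funD => //; exact: measurableT_comp mprev mf1.
have mHA : measurable_fun setT (H \_ A).
  by apply/(measurable_restrictT _ mA); exact: measurable_funS mH.
have HA0 z : (0 <= (H \_ A) z)%E by rewrite patchE; case: ifP => // _; exact: G0.
transitivity (\int[P]_w (H \_ A) (w, X (p k) w))%E.
  rewrite [LHS]integral_mkcond; apply: eq_integral => w _.
  rewrite !patchE /H/= SE.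
  have -> : (w \in [set w | first_passage (S w) (sigma w) k]) =
      ((w, X (p k) w) \in A).
    apply/idP/idP; rewrite !inE /A/= /first_passage SE => -[h1 h2]; by split.
  by [].
rewrite (@integral_independent_history _ _ _ _ _ _ indepX _ _ _ nJ'p)// [RHS]integral_mkcond.
apply: eq_integral => w _; rewrite patchE.
transitivity (\int[nu]_x (H \_ A) (w, x))%E.
  by apply: eq_measure_integral => B mB _; exact: (etrans (Xp k mB) (esym (nuE mB))).
case: ifPn => [|wF]; last first.
  rewrite integral0_eq// => x _; rewrite patchE ifF//; apply/negP; rewrite inE => -[h _].
  by move/negP : wF; apply; rewrite inE.
rewrite inE/= => wF.
rewrite -/(prev w).
transitivity (\int[nu]_(x in `[(sigma w - prev w)%R, +oo[) G (w, (prev w + x - sigma w)%R))%E.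
  rewrite [RHS]integral_mkcond; apply: eq_integral => x _; rewrite !patchE.
  have -> : ((w, x) \in A) = (x \in `[sigma w - prev w, +oo[%classic).
    apply/idP/idP; rewrite !inE /A/= in_itv/= andbT lerBlDl.
      by case.
    by split.
  by [].
have mGw : measurable_fun setT (fun x : R => G (w, prev w + x - sigma w)).
  apply: (measurableT_comp mG); apply: measurable_fun_pair => //.
  by apply: measurable_funB => //; exact: measurable_funD.
rewrite (exponential_memoryless mu_gt0 nuE)//; last exact: y0.
congr (_ * _)%E; apply: eq_integral => x _; congr (G (_, _)); ring.
Qed.

(** The transition operator of one independent exponential wait started at [s], acting on test
    functions. *)
Definition exponential_shift (f : R -> \bar R) (s : R) : \bar R :=
  (\int[nu]_r f (s + r)%R)%E.

Lemma measurable_exponential_shift (f : R -> \bar R) :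
  measurable_fun setT f -> (forall x, 0 <= f x)%E ->
  measurable_fun setT (exponential_shift f).
Proof.
move=> mf f0.
apply: (@measurable_fun_fubini_tonelli_F _ _ R R R nu (fun z => f (z.1 + z.2)))%R => //.
by apply: (measurableT_comp mf); apply: measurable_funD.
Qed.

Lemma exponential_shift_ge0 (f : R -> \bar R) s :
  (forall x, 0 <= f x)%E -> (0 <= exponential_shift f s)%E.
Proof. by move=> f0; apply: integral_ge0. Qed.

(** The first-passage events are pairwise disjoint, and they cover almost all of [Omega] because the
    event times are almost surely unbounded. *)
Lemma ge0_integral_first_passages (sigma : Omega -> R) (g : Omega -> \bar R) :
  measurable_fun setT sigma -> measurable_fun setT g -> (forall w, 0 <= g w)%E ->
  (\int[P]_w g w =
   \sum_(k <oo) \int[P]_(w in [set w | first_passage (S w) (sigma w) k]) g w)%E.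
Proof.
move=> ms mg g0.
pose E k := [set w | first_passage (S w) (sigma w) k].
have mE k : measurable (E k).
  apply: measurable_first_passage => // i.
  by apply: (@measurable_event_time _ _ _ (fun i w => X (p i) w)) => l _.
have mU : measurable (\bigcup_k E k) by exact: bigcupT_measurable.
rewrite -ge0_integral_bigcup//; last 2 first.
- exact: measurable_funS mg.
- apply/trivIsetP => i j _ _ /eqP ij; rewrite -subset0 => w [/= fi fj].
  by apply: ij; exact: first_passage_uniq fi fj.
rewrite [LHS](ge0_negligible_integral _ (N := ~` \bigcup_k E k))//.
- by rewrite setDE setCK setTI.
- exact: measurableC.
- have [N [mN PN sN]] := ae_event_time_unbounded.
  apply/eqP; rewrite eq_le measure_ge0 andbT -PN le_measure ?inE//.
    exact: measurableC.
  move=> w nw; apply: sN => /= h; apply: nw.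
  by have [k fk] := first_passage_exists (h (sigma w)); exists k.
Qed.

(** Strong memorylessness: after a time [sigma] determined by an independent past, the wait for the
    next event is a fresh exponential variable. *)
Lemma integral_next_event (J : set I) (sigma : Omega -> R) (f : R -> \bar R) :
  (forall i, ~ J (p i)) ->
  measurable_fun setT (sigma : history J -> R) -> (forall w, 0 <= sigma w) ->
  measurable_fun setT f -> (forall x, 0 <= f x)%E ->
  (\int[P]_w f (next_event (S w) (sigma w)) =
   \int[P]_w exponential_shift f (sigma w))%E.
Proof.
move=> nJp msigma sigma0 mf f0.
have ms : measurable_fun setT sigma by exact: measurable_from_history msigma.
have mS k : measurable_fun setT (fun w => S w k).
  by apply: (@measurable_event_time _ _ _ (fun i w => X (p i) w)) => l _.
have mphi := measurable_exponential_shift mf f0.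
have phi0 s := exponential_shift_ge0 s f0.
rewrite (ge0_integral_first_passages ms)//; last first.
  exact: (measurableT_comp mf (measurable_next_event mS ms)).
rewrite [RHS](ge0_integral_first_passages ms)//; last exact: measurableT_comp mphi ms.
apply: eq_eseriesr => k _.
(* The exact law of the threshold is never needed: by [integral_first_passage],
   [f] and its exponential average have the same integral. *)
have mfst : measurable_fun setT (fun z : history J * R => sigma z.1).
  by apply: (measurableT_comp msigma); exact: measurable_fst.
transitivity (\int[P]_(w in [set w | first_passage (S w) (sigma w) k])
    f (sigma w + (S w k - sigma w))%R)%E.
  apply: eq_integral => w; rewrite inE /= => fk.
  by rewrite (next_eventE fk) addrC subrK.
rewrite (@integral_first_passage J sigma k (fun z => f (sigma z.1 + z.2)))//; last first.
  by apply: (measurableT_comp mf); apply: measurable_funD.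
rewrite (@integral_first_passage J sigma k
  (fun z => exponential_shift f (sigma z.1)))//; last first.
  exact: (measurableT_comp mphi).
apply: eq_integral => w _ /=.
by rewrite integral_cst//= probability_setT mule1.
Qed.

End renewal.

(** * Sample paths of the line network *)

Section sample_path.
Context {R : realType}.
Implicit Type X : nat -> R.

Definition regular X := (forall k, 0 <= X k) /\ forall M, exists k, M <= event_time X k.

Lemma event_time_ge0 X k : (forall k, 0 <= X k) -> 0 <= event_time X k.
Proof. by move=> X0; apply: sumr_ge0. Qed.

Lemma event_time_nd X : (forall k, 0 <= X k) ->
  {homo event_time X : i j / (i <= j)%N >-> i <= j}.
Proof.
move=> X0; apply: homo_leq => // [y x z xy yz|k]; first exact: le_trans yz.
by rewrite /event_time [leRHS]big_ord_recr/= lerDl.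
Qed.

Lemma last_eventE X t : regular X -> (exists k, event_time X k <= t) ->
  exists k, [/\ last_event X t = event_time X k, event_time X k <= t &
    forall l, event_time X l <= t -> event_time X l <= event_time X k].
Proof.
move=> [X0 ubX] [k0 Sk0]; set S := event_time X in Sk0 ubX *.
have ndS : {homo S : i j / (i <= j)%N >-> i <= j} by exact: event_time_nd.
have e : exists k, t < S k.
  by have [k tk] := ubX (t + 1); exists k; apply: lt_le_trans tk; rewrite ltrDl.
(* The last event at or before [t] is the predecessor of the first one after [t]; index 0 cannot
   come after [t], since [k0] does not. Hence the supremum is attained. *)
case: (ex_minnP e) => -[|k] tk kmin.
  by have := le_lt_trans Sk0 tk; rewrite ltNge ndS.
have Skt : S k <= t by rewrite leNgt; apply/negP => /kmin; rewrite ltnn.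
have Smax l : S l <= t -> S l <= S k.
  move=> lt; apply: (ndS); rewrite -ltnS ltnNge; apply/negP => /ndS kl.
  by have := lt_le_trans tk (le_trans kl lt); rewrite ltxx.
exists k; split => //; apply/eqP; rewrite eq_le; apply/andP; split.
  apply: ge_sup; first by exists (S k), k.
  by move=> _ [l /= lt <-]; exact: Smax.
apply: ub_le_sup; last by exists k.
by exists t => _ [l /= lt <-].
Qed.

Lemma last_event_ge X t v : regular X -> (exists k, event_time X k <= t) ->
  v <= last_event X t <-> exists k, v <= event_time X k <= t.
Proof.
move=> rX /(last_eventE rX)[k [-> kt kmax]]; split => [vk|[l /andP[vl /kmax]]].
  by exists k; rewrite vk kt.
exact: le_trans.
Qed.

End sample_path.

Lemma measurable_exists_before d (T : measurableType d) (R : realType)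
  (X : nat -> T -> R) (t : T -> R) :
  (forall k, measurable_fun setT (X k)) -> measurable_fun setT t ->
  measurable [set w | exists k, event_time (X ^~ w) k <= t w].
Proof.
move=> mX mt.
rewrite (_ : [set w | _] = \bigcup_k [set w | event_time (X ^~ w) k <= t w]).
  by apply: bigcupT_measurable => k; apply: measurable_set_ler => //;
    exact: measurable_event_time.
by apply/seteqP; split=> w /= [k]; [exists k|move=> _ ?; exists k].
Qed.

Lemma measurable_last_event d (T : measurableType d) (R : realType)
  (X : nat -> T -> R) (t : T -> R) :
  (forall k, measurable_fun setT (X k)) -> measurable_fun setT t ->
  measurable_fun setT (fun w => last_event (X ^~ w) (t w)).
Proof.
move=> mX mt; pose S k w := event_time (X ^~ w) k.
have mS k : measurable_fun setT (S k) by exact: measurable_event_time.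
(* With no event up to [t], the supremum of the empty set is 0. *)
have last0 w : ~ (exists k, S k w <= t w) -> last_event (X ^~ w) (t w) = 0.
  move=> n; rewrite /last_event (_ : image _ _ = set0) ?sup0//.
  by rewrite -subset0 => _ [k /= kt _]; apply: n; exists k.
move=> _; apply: (measurability _ (RGenOInfty.measurableE R)) => //.
move=> _ [_ [v ->] <-]; rewrite setTI.
rewrite (_ : _ @^-1` _ =
  (\bigcup_k ([set w | S k w <= t w] `&` [set w | v < S k w]))
  `|` (~` [set w | exists k, S k w <= t w] `&` [set w | v < 0])); last first.
  apply/seteqP; split=> w /=; rewrite in_itv/= andbT.
  - have [[k kt]|n] := pselect (exists k, S k w <= t w); last first.
      by rewrite last0//; right.
    move=> /sup_gt[|_ [l /= lt <-] vl]; first by exists (S k w), k.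
    by left; exists l.
  - move=> [[k _ [kt vk]]|[n v0]]; last by rewrite last0.
    apply: (lt_le_trans vk); apply: ub_le_sup; last by exists k.
    by exists (t w) => _ [l /= lt <-].
apply: measurableU.
  by apply: bigcupT_measurable => k; apply: measurableI;
    [exact: measurable_set_ler|exact: measurable_set_ltr].
apply: measurableI; last exact: measurable_set_ltr.
by apply: measurableC; exact: measurable_exists_before.
Qed.

Section line.
Context {R : realType} {Omega : Type} {n : nat}.
Context (x0 : 'I_n -> R) (T : 'I_n -> nat -> Omega -> R).

(** This and [initial_age] copy the local extensions by 0 used inside [gen_time], so that
    [gen_timeE] holds by computation. *)
Definition interarrival (j k : nat) (w : Omega) : R :=
  oapp (fun i => T i k w) 0 (insub j).

Definition initial_age (j : nat) : R := oapp x0 0 (insub j).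

Lemma interarrivalE (j : 'I_n) k w : interarrival j k w = T j k w.
Proof. by rewrite /interarrival valK. Qed.

Definition upstream_time (j : nat) (t : R) (w : Omega) : R :=
  if j is j'.+1 then gen_time x0 T j' t w else t.

Lemma gen_timeE j t w : gen_time x0 T j t w =
  if `[< exists k, event_time (interarrival j ^~ w) k <= t >] then
    upstream_time j (last_event (interarrival j ^~ w) t) w
  else - initial_age j.
Proof. by case: j. Qed.

(* The earliest time at which an update generated at or after [u] has reached
   node j (node 0 being the source). *)
Fixpoint delivery_time (u : R) (j : nat) (w : Omega) : R :=
  if j is j'.+1 then
    next_event (event_time (interarrival j' ^~ w)) (delivery_time u j' w)
  else u.

Lemma delivery_timeS u j w : delivery_time u j.+1 w =
  next_event (event_time (interarrival j ^~ w)) (delivery_time u j w).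
Proof. by []. Qed.

(** Duality between stamps traced backward and updates followed forward. The stamp at node [j.+1] is
    looked up at its last event, so induction, with [t] arbitrary, asks that this event be no
    earlier than the delivery upstream; equivalently, some event lies between that delivery and [t].
    As [u > 0], an initial stamp never qualifies. *)
Lemma gen_time_ge u j t w : 0 < u -> (forall i, 0 <= initial_age i) ->
  (forall i, (i <= j)%N -> regular (interarrival i ^~ w)) ->
  u <= gen_time x0 T j t w <-> delivery_time u j.+1 w <= t.
Proof.
move=> u0 a0; elim: j t => [|j IH] t rj; rewrite gen_timeE.
- have rX := rj 0%N (leqnn _).
  rewrite delivery_timeS next_event_le; last 2 first.
  + by apply: event_time_nd; case: rX.
  + by case: rX.
  case: asboolP => [e|ne]; first exact: last_event_ge.
  split=> [|[k /andP[_ kt]]]; last by case: ne; exists k.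
  by move=> /(lt_le_trans u0); rewrite ltNge oppr_le0 a0.
- have rX := rj j.+1 (leqnn _).
  have IHt t' := IH t' (fun i ij => rj i (leqW ij)).
  rewrite delivery_timeS next_event_le; last 2 first.
  + by apply: event_time_nd; case: rX.
  + by case: rX.
  case: asboolP => [e|ne].
    exact: (iff_trans (IHt _) (last_event_ge _ rX e)).
  split=> [|[k /andP[_ kt]]]; last by case: ne; exists k.
  by move=> /(lt_le_trans u0); rewrite ltNge oppr_le0 a0.
Qed.

Lemma gen_time_bounds (C : R) j t w : 0 <= t ->
  (forall i, 0 <= initial_age i <= C) ->
  (forall i, (i <= j)%N -> regular (interarrival i ^~ w)) ->
  - C <= gen_time x0 T j t w <= t.
Proof.
move=> t0 aC; elim: j t t0 => [|j IH] t t0 rj; rewrite gen_timeE.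
- have rX := rj 0%N (leqnn _); have [a0 aC0] := andP (aC 0%N).
  case: asboolP => [/(last_eventE rX)[k [-> kt _]]|_].
    rewrite /= kt andbT (le_trans _ (event_time_ge0 _ _))//; last by case: rX.
    by rewrite oppr_le0 (le_trans a0).
  by rewrite lerN2 aC0 (le_trans _ t0)// oppr_le0.
- have rX := rj j.+1 (leqnn _); have [a0 aC0] := andP (aC j.+1).
  case: asboolP => [/(last_eventE rX)[k [-> kt _]]|_].
    have S0 : 0 <= event_time (interarrival j.+1 ^~ w) k.
      by apply: event_time_ge0; case: rX.
    have /andP[-> h] := IH _ S0 (fun i ij => rj i (leqW ij)).
    exact: le_trans h kt.
  by rewrite lerN2 aC0 (le_trans _ t0)// oppr_le0.
Qed.

End line.

(** The observation time is random because the recursion queries the upstream node at the random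
    time [last_event]. *)
Lemma measurable_gen_time d (Omega : measurableType d) (R : realType) n
  (x0 : 'I_n -> R) (T : 'I_n -> nat -> Omega -> R) j (t : Omega -> R) :
  (forall i k, measurable_fun setT (T i k)) -> measurable_fun setT t ->
  measurable_fun setT (fun w => gen_time x0 T j (t w) w).
Proof.
move=> mT.
have mX i k : measurable_fun setT (interarrival T i k).
  by rewrite /interarrival; case: insub => [l|] /=.
have step i s : measurable_fun setT s ->
    (forall s', measurable_fun setT s' ->
      measurable_fun setT (fun w => upstream_time x0 T i (s' w) w)) ->
    measurable_fun setT (fun w => gen_time x0 T i (s w) w).
  move=> ms mU; under eq_fun do rewrite gen_timeE.
  apply: measurable_fun_ifT => //; last by apply: mU; exact: measurable_last_event.
  apply: (@measurable_fun_bool _ _ _ _ true); rewrite setTI.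
  rewrite (_ : _ @^-1` _ = [set w | exists k, event_time (interarrival T i ^~ w) k <= s w]).
    exact: measurable_exists_before.
  by apply/seteqP; split=> w /= /asboolP.
by elim: j t => [|j IH] t mt; apply: step.
Qed.

(** * Law and moments of the delivery times *)

Section line_network.
Context {R : realType} {d : measure_display} {Omega : measurableType d}.
Context {P : probability Omega R} {n : nat} (mu : 'I_n -> R).
Context (T : 'I_n -> nat -> {RV P >-> R}).
Hypothesis mu_gt0 : forall l, 0 < mu l.
Hypothesis T_exp : forall l k A, measurable A ->
  distribution P (T l k) A = exponential_prob (mu l) A.
Local Notation X := (fun p : 'I_n * nat => T p.1 p.2).
Hypothesis T_indep : mutually_independent X.

Local Notation delivery := (@delivery_time R Omega n (fun l k => T l k)).
Local Notation tau := (@interarrival R Omega n (fun l k => T l k)).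
Local Notation nu l := (distribution P (T l 0%N)).

Lemma interarrival_ord (l : 'I_n) k w : tau l k w = T l k w.
Proof. exact: interarrivalE. Qed.

Local Notation before i := [set p : 'I_n * nat | (p.1 < i)%N].

(** Delivery through the first [i] processes involves only those processes, which makes process [i]
    independent of it. *)
Lemma measurable_delivery_history u i : (i <= n)%N ->
  measurable_fun setT (delivery u i : g_sigma_algebraType (cylinder X (before i)) -> R).
Proof.
elim: i => [|i IH] lin; first exact: measurable_cst.
apply: measurable_next_event => [k|]; last first.
  apply: (measurable_history_sub _ (IH (ltnW lin))) => p /=.
  exact: ltnW.
apply: (@measurable_event_time _
  (g_sigma_algebraType (cylinder X (before i.+1))) _ (tau i)) => l _.
rewrite (_ : tau i l = X (Ordinal lin, l)); last first.
  by apply/funext => w; exact: (interarrival_ord (Ordinal lin)).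
by apply: measurable_history; rewrite /=.
Qed.

Lemma measurable_delivery u i : (i <= n)%N -> measurable_fun setT (delivery u i).
Proof. by move=> /(measurable_delivery_history u); exact: measurable_from_history. Qed.

Lemma delivery_ge0 u i w : 0 <= u -> 0 <= delivery u i w.
Proof. by move=> u0; elim: i => //= i IH; exact: next_event_ge0. Qed.

Lemma integral_deliveryS u (l : 'I_n) (f : R -> \bar R) : 0 <= u ->
  measurable_fun setT f -> (forall x, 0 <= f x)%E ->
  (\int[P]_w f (delivery u l.+1 w) =
   \int[P]_w exponential_shift (nu l) f (delivery u l w))%E.
Proof.
move=> u0 mf f0.
have tauE w : tau l ^~ w = (fun k => X (l, k) w).
  by apply/funext => k; exact: interarrival_ord.
under eq_integral do rewrite delivery_timeS tauE.
apply: (integral_next_event T_indep (mu_gt0 l) (T_exp l 0%N) (p := pair l) _ _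
  (J := before l)) => //.
- by move=> i j [].
- by move=> k A mA; exact: T_exp.
- by move=> k; rewrite /= ltnn.
- by apply: measurable_delivery_history; exact: ltnW.
- by move=> w; exact: delivery_ge0.
Qed.

(** The travel time has the same law whatever the starting time: each step acts by
    [exponential_shift], which commutes with translations. The induction replaces the test function
    [f] by its exponential average [g]. *)
Lemma integral_delivery_shift u i (f : R -> \bar R) : 0 <= u -> (i <= n)%N ->
  measurable_fun setT f -> (forall x, 0 <= f x)%E ->
  (\int[P]_w f (delivery u i w - u)%R = \int[P]_w f (delivery 0%R i w))%E.
Proof.
move=> u0; elim: i f => [|i IH] f lin mf f0.
  by apply: eq_integral => w _ /=; rewrite subrr.
pose l := Ordinal lin; pose g := exponential_shift (nu l) f.
have mg : measurable_fun setT g by exact: measurable_exponential_shift.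
have g0 x : (0 <= g x)%E by exact: exponential_shift_ge0.
have mfu : measurable_fun setT (fun x : R => f (x - u)%R).
  by apply: (measurableT_comp mf); exact: measurable_funB.
have /= -> := integral_deliveryS l (lexx 0) mf f0.
have /= -> := integral_deliveryS l u0 mfu (fun x => f0 (x - u)).
rewrite -(IH g (ltnW lin) mg g0).
apply: eq_integral => w _; rewrite /g /exponential_shift.
by apply: eq_integral => r _; rewrite addrAC.
Qed.

(* The absolute value makes the integrand nonnegative on all of R; delivery times
   are nonnegative. *)
Definition delivery_moment i m : \bar R := (\int[P]_w (`|delivery 0%R i w| ^+ m)%:E)%E.

Lemma measurable_normX m : measurable_fun setT (fun x : R => (`|x| ^+ m)%:E).
Proof.
by apply/measurable_EFinP; apply: measurable_funX; exact: normr_measurable.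
Qed.

Lemma delivery_moment0 i : delivery_moment i 0 = 1%E.
Proof.
rewrite /delivery_moment; under eq_integral do rewrite expr0.
by rewrite integral_cst//= probability_setT mule1.
Qed.

Lemma delivery_momentS (l : 'I_n) m : delivery_moment l.+1 m.+1 =
  (delivery_moment l m.+1 + (m.+1%:R / mu l)%:E * delivery_moment l.+1 m)%E.
Proof.
pose f m (x : R) : \bar R := (`|x| ^+ m)%:E.
have mf k : measurable_fun setT (f k) by exact: measurable_normX.
have f0 k x : (0 <= f k x)%E by rewrite lee_fin.
have md : measurable_fun setT (delivery 0 l) by apply: measurable_delivery; exact: ltnW.
have ms k : measurable_fun setT (exponential_shift (nu l) (f k)).
  exact: measurable_exponential_shift.
have s0 k x : (0 <= exponential_shift (nu l) (f k) x)%E by exact: exponential_shift_ge0.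
have c0 : (0 <= (m.+1%:R / mu l)%:E)%E by rewrite lee_fin divr_ge0// ltW.
have shiftS s : 0 <= s -> exponential_shift (nu l) (f m.+1) s =
    (f m.+1 s + (m.+1%:R / mu l)%:E * exponential_shift (nu l) (f m) s)%E.
  move=> s_ge0; rewrite /f ger0_norm//.
  exact: (integral_exponential_shift_expS (mu_gt0 l) (T_exp l 0%N)).
rewrite /delivery_moment.
rewrite (integral_deliveryS l (f := f m.+1))// (integral_deliveryS l (f := f m))//.
under eq_integral do rewrite shiftS ?delivery_ge0//.
rewrite ge0_integralD//; last 3 first.
- exact: measurableT_comp (mf _) md.
- by move=> w _; rewrite mule_ge0.
- apply: emeasurable_funM => //; exact: measurableT_comp (ms _) md.
by rewrite ge0_integralZl//; exact: measurableT_comp (ms _) md.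
Qed.

Lemma delivery_momentE (l : 'I_n) m : delivery_moment l.+1 m =
  ((m`!)%:R * ((const_mx 1 : 'rV[R]_n) *m Umx mu ^+ m) ord0 l)%:E.
Proof.
elim: m l => [|m IH] l.
  by rewrite delivery_moment0 expr0 fact0 mul1r mulmx1 mxE.
(* The increment of the moment of order [m.+1] contributed by process [i]. Summing over [i <= l] is
   multiplication by column [l] of [Umx mu]; the sum starts at 0 because the delivery time at the
   source is 0. *)
pose v (i : 'I_n) : R := m.+1`!%:R * ((const_mx 1 : 'rV[R]_n) *m Umx mu ^+ m) ord0 i / mu i.
have partial k : (k <= n)%N ->
    delivery_moment k m.+1 = (\sum_(i < n | (i < k)%N) v i)%:E.
  elim: k => [_|k IHk kn].
    rewrite /delivery_moment/= normr0 expr0n/= integral0 big_pred0//.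
  have /= -> := delivery_momentS (Ordinal kn) m.
  have /= -> := IH (Ordinal kn).
  rewrite (IHk (ltnW kn)) -EFinM -EFinD.
  rewrite [in RHS](bigD1 (Ordinal kn))//= addrC; congr (_ + _)%:E.
    by apply: eq_bigl => i; rewrite -val_eqE/= ltnS ltn_neqAle andbC.
  by rewrite /v factS natrM; ring.
rewrite partial//; congr EFin.
rewrite exprSr -mulmxE mulmxA [in RHS]mxE big_distrr/= [LHS]big_mkcond/=.
apply: eq_bigr => i _; rewrite [Umx _ _ _]mxE ltnS.
by case: ifP => _; rewrite ?mulr0// /v mulrA.
Qed.

Lemma ae_regular : {ae P, forall w, forall i, (i < n)%N -> regular (tau i ^~ w)}.
Proof.
apply/ae_foralln => i; case: (ltnP i n) => [lin|_]; last exact: aeW.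
pose l := Ordinal lin.
have Tp k A : measurable A -> distribution P (X (l, k)) A = exponential_prob (mu l) A.
  exact: T_exp.
have l_inj : injective (pair l : nat -> 'I_n * nat) by move=> a b [].
have := ae_event_time_unbounded T_indep (mu_gt0 l) (T_exp l 0%N) l_inj Tp.
have := ae_interarrival_ge0 (mu_gt0 l) (T_exp l 0%N)
  (X := X) (p := pair l) Tp.
apply: filterS2 => w T0 unb _.
have tauE : tau i ^~ w = (fun k => X (l, k) w).
  by apply/funext => k; exact: (interarrival_ord l).
by rewrite tauE; split.
Qed.

Context (x0 : 'I_n -> R).
Hypothesis x0_ge0 : forall j, 0 <= x0 j.
Context (j : 'I_n).

Local Notation age := (fun t w => line_age x0 (fun l k => T l k) j t w).
Local Notation age_limit := (delivery 0 j.+1).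

Lemma measurable_age t : measurable_fun setT (age t).
Proof.
apply: measurable_funB => //.
exact: (measurable_gen_time x0 j (fun i k => measurable_funPT (T i k)) (measurable_cst t)).
Qed.

Lemma measurable_age_limit : measurable_fun setT age_limit.
Proof. exact: measurable_delivery. Qed.

Lemma initial_age_ge0 i : 0 <= initial_age x0 i.
Proof. by rewrite /initial_age; case: insub => //=. Qed.

Lemma initial_age_le i : initial_age x0 i <= \sum_l x0 l.
Proof.
rewrite /initial_age; case: insub => [l|] /=; last exact: sumr_ge0.
by rewrite (bigD1 l)//= lerDl sumr_ge0.
Qed.

Lemma ae_age_bounds t : 0 <= t -> {ae P, forall w, 0 <= age t w <= t + \sum_l x0 l}.
Proof.
move=> t0; have := ae_regular; apply: filterS => w rw.
have rj i : (i <= j)%N -> regular (tau i ^~ w) by move=> ij; apply: rw; exact: leq_ltn_trans ij _.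
have a0 i : 0 <= initial_age x0 i <= \sum_l x0 l.
  by rewrite initial_age_ge0 initial_age_le.
have /andP[h1 h2] := gen_time_bounds t0 a0 rj.
by rewrite /line_age subr_ge0 h2/= lerD2l lerNl.
Qed.

(** The age exceeds [a] when the stamp is below [t - a], that is, by duality at [u = t - a], when no
    update generated from then on has arrived by time [t]. *)
Lemma ae_age_gt t a : a < t ->
  {ae P, forall w, (a < age t w) = (a < delivery (t - a) j.+1 w - (t - a))}.
Proof.
move=> at_; have := ae_regular; apply: filterS => w rw.
have rj i : (i <= j)%N -> regular (tau i ^~ w) by move=> ij; apply: rw; exact: leq_ltn_trans ij _.
have ta : 0 < t - a by rewrite subr_gt0.
have h := gen_time_ge t ta initial_age_ge0 rj.
rewrite /line_age !ltNge; congr (~~ _).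
have -> : (t - gen_time x0 (fun l k => T l k) j t w <= a) =
    (t - a <= gen_time x0 (fun l k => T l k) j t w) by rewrite lerBlDr lerBlDl addrC.
have -> : (delivery (t - a) j.+1 w - (t - a) <= a) = (delivery (t - a) j.+1 w <= t).
  by rewrite lerBlDr [a + _]addrC subrK.
by apply/idP/idP => /h.
Qed.

Lemma measurable_minl (g : Omega -> R) (t : R) : measurable_fun setT g ->
  measurable_fun setT (fun w => Num.min (g w) t).
Proof. by move=> mg; apply: measurable_minr. Qed.

(** Truncating at [t] makes the identity hold at all levels: for [a >= t] both events are empty, for
    [a < 0] both are almost sure, and in between duality applies. *)
Lemma age_ccdf t a : 0 < t ->
  P [set w | a < Num.min (age t w) t] = P [set w | a < Num.min (age_limit w) t].
Proof.
move=> t0.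
have mx := measurable_age t; have mH := measurable_age_limit.
pose f (x : R) : \bar R := (\1_(`]a, +oo[%classic : set R) x)%:E.
have mf : measurable_fun setT f by apply/measurable_EFinP; exact: measurable_indic.
have f0 x : (0 <= f x)%E by rewrite lee_fin.
have PE (g : Omega -> R) : measurable_fun setT g ->
    P [set w | a < g w] = (\int[P]_w f (g w))%E.
  move=> mg; rewrite -[X in P X]setIT -integral_indic//; last exact: measurable_set_ltr.
  apply: eq_integral => w _; rewrite /f !indicE; congr (_%:R%:E).
  by congr nat_of_bool; apply/idP/idP; rewrite !inE/= in_itv/= andbT.
have [ta|at_] := leP t a.
  congr (P _); apply/seteqP; split=> w /=.
    by rewrite lt_min => /andP[_]; rewrite ltNge ta.
  by rewrite lt_min => /andP[_]; rewrite ltNge ta.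
have minE (g : Omega -> R) : [set w | a < Num.min (g w) t] = [set w | a < g w].
  by apply/seteqP; split=> w /=; rewrite lt_min at_ andbT.
rewrite !minE !PE//.
have [a0|a0] := leP 0 a; last first.
  apply: ge0_ae_eq_integral => //; [exact: measurableT_comp mf _|exact: measurableT_comp mf _|].
  have := ae_age_bounds (ltW t0); apply: filterS => w /andP[x_ge0 _] _.
  have f1 y : 0 <= y -> f y = 1%E.
    by move=> y0; rewrite /f indicE mem_set//= in_itv/= andbT (lt_le_trans a0).
  by rewrite !f1//; exact: delivery_ge0.
have u0 : 0 <= t - a by rewrite subr_ge0 ltW.
have ln : (j.+1 <= n)%N by [].
(* The travel time started at 0 is exchanged for the one started at [t - a], which duality relates
   to the age at time [t]. *)
rewrite -(integral_delivery_shift u0 ln mf f0).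
have md : measurable_fun setT (fun w => delivery (t - a) j.+1 w - (t - a)).
  by apply: measurable_funB => //; exact: measurable_delivery.
apply: ge0_ae_eq_integral => //; [exact: measurableT_comp mf mx|exact: measurableT_comp mf md|].
have := ae_age_gt at_; apply: filterS => w h _; rewrite /f !indicE; congr (_%:R%:E).
congr nat_of_bool; apply/idP/idP; rewrite !inE/= !in_itv/= !andbT ?h// -h//.
Qed.

Lemma integral_min_age t (f : R -> \bar R) : 0 < t ->
  measurable_fun setT f -> (forall x, 0 <= f x)%E ->
  (\int[P]_w f (Num.min (age t w) t) = \int[P]_w f (Num.min (age_limit w) t))%E.
Proof.
move=> t0 mf f0.
have mY := measurable_minl t (measurable_age t).
have mZ := measurable_minl t measurable_age_limit.
pose Y : {mfun Omega >-> R} := HB.pack (fun w => Num.min (age t w) t)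
  (isMeasurableFun.Build _ _ _ _ _ mY).
pose Z : {mfun Omega >-> R} := HB.pack (fun w => Num.min (age_limit w) t)
  (isMeasurableFun.Build _ _ _ _ _ mZ).
transitivity (\int[distribution P Y]_y f y)%E; first by rewrite ge0_integral_distribution.
transitivity (\int[distribution P Z]_y f y)%E; last by rewrite ge0_integral_distribution.
apply: eq_measure_integral => A mA _.
apply: (measure_unique (@RGenOInfty.G R) (fun k => `]- k%:R, +oo[%classic)) => //.
- exact: RGenOInfty.measurableE.
- move=> _ _ [a ->] [b ->]; exists (Num.max a b).
  by apply/seteqP; split=> r /=; rewrite !in_itv/= !andbT gt_max; [move=> [-> ->]|move/andP].
- by move=> k; exists (- k%:R).
- rewrite -subTset => r _; exists (Num.truncn `|r|).+1 => //=.
  rewrite in_itv/= andbT ltrNl (le_lt_trans (ler_norm _))// normrN.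
  by rewrite truncnS_gt.
- move=> _ [a ->].
  have E (g : Omega -> R) : g @^-1` `]a, +oo[%classic = [set w | a < g w].
    by apply/seteqP; split=> w /=; rewrite in_itv/= andbT.
  rewrite /= /distribution /pushforward/= !E; exact: age_ccdf.
- by move=> k; rewrite (le_lt_trans (probability_le1 _ _)) ?ltry.
Qed.

End line_network.

(** * Convergence of the moments *)

Section moment_bounds.
Context {R : realType} {d : measure_display} {Omega : measurableType d}.
Context {P : probability Omega R} {n : nat} (mu : 'I_n -> R).
Context (T : 'I_n -> nat -> {RV P >-> R}).
Hypothesis mu_gt0 : forall l, 0 < mu l.
Hypothesis T_exp : forall l k A, measurable A ->
  distribution P (T l k) A = exponential_prob (mu l) A.
Hypothesis T_indep : mutually_independent (fun p : 'I_n * nat => T p.1 p.2).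
Context (x0 : 'I_n -> R).
Hypothesis x0_ge0 : forall j, 0 <= x0 j.
Context (j : 'I_n).
Local Notation age := (fun t w => line_age x0 (fun l k => T l k) j t w).
Local Notation age_limit := (@delivery_time R Omega n (fun l k => T l k) 0 j.+1).
Local Notation moment := (delivery_moment T j.+1).

Let mx t : measurable_fun setT (age t) := measurable_age T x0 j t.
Let mH : measurable_fun setT age_limit := measurable_age_limit T j.
Let mnorm m (g : Omega -> R) : measurable_fun setT g ->
  measurable_fun setT (fun w => (`|g w| ^+ m)%:E).
Proof. by move=> mg; exact: (measurableT_comp (measurable_normX m) mg). Qed.

Lemma integral_add_scaled_norm (g h : Omega -> R) (c : R) m k : 0 <= c ->
  measurable_fun setT g -> measurable_fun setT h ->
  (\int[P]_w ((`|g w| ^+ m)%:E + c%:E * (`|h w| ^+ k)%:E) =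
   \int[P]_w (`|g w| ^+ m)%:E + c%:E * \int[P]_w (`|h w| ^+ k)%:E)%E.
Proof.
move=> c0 mg mh.
rewrite ge0_integralD//; last 3 first.
- exact: mnorm.
- by move=> w _; rewrite mule_ge0 ?lee_fin.
- by apply: emeasurable_funM => //; exact: mnorm.
by rewrite ge0_integralZl// ?lee_fin//; exact: mnorm.
Qed.

(* Both bounds follow from min(age, t) ~ min(age_limit, t) in law, the error on the
   event age_limit >= t being absorbed into the next moment as in Markov's
   inequality. *)
Lemma age_moment_ge m t : 0 < t ->
  (moment m <= \int[P]_w (`|age t w| ^+ m)%:E + (t^-1)%:E * moment m.+1)%E.
Proof.
move=> t0; have ti0 : 0 <= t^-1 by rewrite invr_ge0 ltW.
have mmin := measurable_minl t mH.
rewrite /delivery_moment.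
apply: (@le_trans _ _ (\int[P]_w ((`|Num.min (age_limit w) t| ^+ m)%:E +
    (t^-1)%:E * (`|age_limit w| ^+ m.+1)%:E))%E).
  apply: ge0_le_integral => //.
  - exact: mnorm.
  - by apply: emeasurable_funD; [exact: mnorm|apply: emeasurable_funM => //; exact: mnorm].
  - move=> w _; rewrite -EFinM -EFinD lee_fin.
    have H0 : 0 <= age_limit w by exact: delivery_ge0.
    case: (leP (age_limit w) t) => Ht; first by rewrite lerDl mulr_ge0.
    rewrite (ger0_norm H0) exprS mulrA.
    have : 1 <= t^-1 * age_limit w by rewrite mulrC ler_pdivlMr// mul1r ltW.
    move=> /(ler_wpM2r (exprn_ge0 m H0)); rewrite mul1r => /le_trans; apply.
    by rewrite lerDr.
rewrite integral_add_scaled_norm//; apply: leeD => //.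
rewrite -(integral_min_age mu_gt0 T_exp T_indep x0_ge0 j (f := fun x => (`|x| ^+ m)%:E) t0)//;
  last exact: measurable_normX.
apply: ae_ge0_le_integral => //.
- by apply: mnorm; exact: measurable_minl.
- exact: mnorm.
- have := ae_age_bounds mu_gt0 T_exp T_indep x0_ge0 j (ltW t0).
  apply: filterS => w /andP[x_ge0 _] _.
  have m_ge0 : 0 <= Num.min (age t w) t by rewrite le_min x_ge0 ltW.
  rewrite (ger0_norm m_ge0) (ger0_norm x_ge0) lee_fin.
  by rewrite lerXn2r ?nnegrE// ge_min lexx.
Qed.

Lemma age_moment_le m t : 0 < t -> \sum_l x0 l <= t ->
  (\int[P]_w (`|age t w| ^+ m)%:E <= moment m + (2 ^+ m / t)%:E * moment m.+1)%E.
Proof.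
move=> t0 Ct; have c0 : 0 <= 2 ^+ m / t by rewrite divr_ge0 ?exprn_ge0// ltW.
(* A function of the truncated age that dominates the power of the true age: an age of at least [t]
   is still at most [t + \sum_l x0 l <= 2 * t]. *)
pose f (x : R) : \bar R := (`|x| ^+ m + (2 * t) ^+ m * \1_(`[t, +oo[%classic : set R) x)%:E.
have mf : measurable_fun setT f.
  apply/measurable_EFinP; apply: measurable_funD.
    by apply: measurable_funX; exact: normr_measurable.
  by apply: measurable_funM => //; exact: measurable_indic.
have t2 : 0 <= (2 * t) ^+ m by rewrite exprn_ge0// mulr_ge0// ltW.
have f0 x : (0 <= f x)%E by rewrite lee_fin addr_ge0// mulr_ge0.
have fge x : t <= x -> f x = (`|x| ^+ m + (2 * t) ^+ m)%:E.
  by move=> tx; rewrite /f indicE mem_set/= ?mulr1// in_itv/= tx.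
have flt x : x < t -> f x = (`|x| ^+ m)%:E.
  move=> tx; rewrite /f indicE memNset/= ?mulr0 ?addr0// in_itv/= andbT.
  by apply/negP; rewrite -ltNge.
apply: (@le_trans _ _ (\int[P]_w f (Num.min (age t w) t))%E).
  apply: ae_ge0_le_integral => //.
  - exact: mnorm.
  - exact: (measurableT_comp mf (measurable_minl t (@mx t))).
  - have := ae_age_bounds mu_gt0 T_exp T_indep x0_ge0 j (ltW t0).
    apply: filterS => w /andP[x_ge0 xt] _.
    case: (ltP (age t w) t) => xt'; first by rewrite flt.
    rewrite fge// lee_fin; apply: (@le_trans _ _ ((2 * t) ^+ m)); last by rewrite lerDr.
    have tt0 : 0 <= 2 * t by rewrite mulr_ge0// ltW.
    rewrite (ger0_norm x_ge0) lerXn2r ?nnegrE//.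
    by rewrite (le_trans xt)// mulr_natl mulr2n lerD2l.
rewrite (integral_min_age mu_gt0 T_exp T_indep x0_ge0 j t0 mf f0).
rewrite /delivery_moment -integral_add_scaled_norm//.
apply: ge0_le_integral => //.
- exact: (measurableT_comp mf (measurable_minl t mH)).
- by apply: emeasurable_funD; [exact: mnorm|apply: emeasurable_funM => //; exact: mnorm].
- move=> w _; rewrite -EFinM -EFinD.
  have H0 : 0 <= age_limit w by exact: delivery_ge0.
  case: (ltP (age_limit w) t) => Ht; first by rewrite flt// lee_fin lerDl mulr_ge0.
  rewrite fge// lee_fin (ger0_norm H0) (gtr0_norm t0); apply: lerD.
    by rewrite lerXn2r ?nnegrE// ltW.
  (* Cancelling [2 ^+ m], what remains is [t ^+ m.+1 <= age_limit w ^+ m.+1]. *)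
  rewrite exprMn -mulrA ler_wpM2l ?exprn_ge0// ler_pdivlMl// -exprS.
  by rewrite lerXn2r ?nnegrE// ltW.
Qed.

End moment_bounds.

Theorem theorem4 (R : realType) (d : measure_display) (Omega : measurableType d)
  (P : probability Omega R) (n : nat) (mu : 'I_n -> R) (x0 : 'I_n -> R)
  (T : 'I_n -> nat -> {RV P >-> R}) :
  (forall l, 0 < mu l) ->
  (forall j, 0 <= x0 j) ->
  (forall l k A, measurable A ->
     distribution P (T l k) A = exponential_prob (mu l) A) ->
  mutually_independent (fun p : 'I_n * nat => T p.1 p.2) ->
  forall m : nat, (0 < m)%N ->
  forall j : 'I_n,
    (fun t : R => ('E_P[fun w => (line_age x0 (fun l k => T l k) j t w ^+ m)%R])%E)
      @ +oo --> (((m`!)%:R * ((const_mx 1 : 'rV[R]_n) *m Umx mu ^+ m) (@ord0 0) j)%:E)%E.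
Proof.
move=> mu_gt0 x0_ge0 T_exp T_indep m _ j.
pose c k : R := (k`!)%:R * ((const_mx 1 : 'rV[R]_n) *m Umx mu ^+ k) ord0 j.
have cE k : delivery_moment T j.+1 k = (c k)%:E by exact: delivery_momentE.
have c0 k : 0 <= c k by rewrite -lee_fin -cE; apply: integral_ge0.
(* One error constant for both sides: the upper bound requires [2 ^+ m * c m.+1], and the lower
   bound's [c m.+1] is no larger. *)
pose K := 2 ^+ m * c m.+1.
have K0 : 0 <= K by rewrite mulr_ge0// exprn_ge0.
have cvgK : K / t @[t --> +oo] --> 0.
  apply/(@cvgrPdist_lt _ R^o) => e e0; near=> t.
  have t0 : 0 < t by near: t; apply: nbhs_pinfty_gt; rewrite num_real.
  have Kt : 0 <= K / t by rewrite divr_ge0// ltW.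
  rewrite sub0r normrN ger0_norm// ltr_pdivrMr// -ltr_pdivrMl//.
  by near: t; apply: nbhs_pinfty_gt; rewrite num_real.
apply: (@squeeze_cvge _ _ _ _ (fun t => (c m - K / t)%:E) _ (fun t => (c m + K / t)%:E)).
- near=> t.
  have t0 : 0 < t by near: t; apply: nbhs_pinfty_gt; rewrite num_real.
  have Ct : \sum_l x0 l <= t by near: t; apply: nbhs_pinfty_ge; rewrite num_real.
  (* The age is almost surely nonnegative, so absolute values may be inserted to match the moment
     bounds. *)
  have -> : ('E_P[fun w => (line_age x0 (fun l k => T l k) j t w ^+ m)%R] =
      \int[P]_w (`|line_age x0 (fun l k => T l k) j t w| ^+ m)%:E)%E.
    rewrite unlock; apply: ae_eq_integral => //.
    + apply/measurable_EFinP; apply: measurable_funX; exact: measurable_age.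
    + exact: (measurableT_comp (measurable_normX m) (measurable_age T x0 j t)).
    + have := ae_age_bounds mu_gt0 T_exp T_indep x0_ge0 j (ltW t0).
      by apply: filterS => w /andP[x_ge0 _] _; rewrite ger0_norm.
  have lo := age_moment_ge mu_gt0 T_exp T_indep x0_ge0 j m t0.
  have up := age_moment_le mu_gt0 T_exp T_indep x0_ge0 j m t0 Ct.
  rewrite !cE in lo up; apply/andP; split.
    rewrite EFinB leeBlDr//; apply: (le_trans lo); rewrite leeD2l// -EFinM lee_fin.
    rewrite mulrC /K ler_pM2r ?invr_gt0// ler_peMl//.
    by rewrite exprn_ege1// ler1n.
  by apply: (le_trans up); rewrite -EFinM -EFinD lee_fin mulrAC.
- apply: cvg_EFin; first exact: nearW.
  rewrite -[X in _ --> X]subr0.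
  by apply: cvgB; [exact: cvg_cst|exact: cvgK].
- apply: cvg_EFin; first exact: nearW.
  rewrite -[X in _ --> X]addr0.
  by apply: cvgD; [exact: cvg_cst|exact: cvgK].
Unshelve. all: by end_near. Qed.
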